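(* At any time during any sequence of operations on two-parent hollow heaps (as defined in the context), the following rank invariant holds: a node $u$ of rank $r$ has exactly $r$ virtual children, of ranks $0,1,\ldots,r-1$, unless $r>2$ and $u$ was made hollow by a decrease-key, in which case $u$ has exactly two virtual children, of ranks $r-2$ and $r-1$.
   Context: Heaps. A heap stores a finite set of items, each with a key from a totally ordered universe, and supports: make-heap() (return an empty heap); find-min($h$) (return an item of minimum key in $h$, or null if $h$ is empty); insert($e,k,h$) (add item $e$, which is in no heap, with key $k$); delete-min($h$) (delete from non-empty $h$ the item that find-min($h$) returns); meld($h_1,h_2$) (return a heap containing all items of the item-disjoint heaps $h_1,h_2$); decrease-key($e,k,h$) (given an item $e$ in $h$ with key greater than $k$, change its key to $k$); delete($e,h$) (delete item $e$ from $h$). Heaps passed as arguments are destroyed; decrease-key and delete are given the location of $e$. Nodes. Nodes hold items: each node holds at most one item, and is full if it holds one and hollow otherwise; each item in a heap is held by exactly one node; a newly created node is full and a hollow node never becomes full again. Each node $u$ has a key $u.key$ (the current key of its item if $u$ is full; if $u$ is hollow, the key its item had just before leaving $u$) and a non-negative integer rank $u.rank$. A tree (or dag) of nodes with arcs from parent to child is heap-ordered if $v.key\le w.key$ for every arc $(v,w)$; a root is a node with no parent. For two full roots, link makes the one of larger key (ties broken arbitrarily) a child of the other; the new child is the loser and the other the winner. A ranked link is a link of two roots of equal rank and increases the winner's rank by one; an unranked link may be applied to any two full roots and changes no ranks. Two-parent hollow heap. It is either empty or a heap-ordered directed acyclic graph of nodes with one root, which is full; the root is the minimum node. make-heap returns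 an empty heap; find-min returns the item in the root; meld returns one heap if the other is empty, and otherwise does an unranked link of the two roots; insert($e,k,h$) creates a new full node of rank 0 holding $e$ with key $k$ and melds this one-node heap with $h$. decrease-key($e,k,h$), with $u$ the node holding $e$: if $u$ is the root one may simply set $u.key=k$; otherwise create a new node $v$, move $e$ from $u$ to $v$ (so $u$ becomes hollow), set $v.key=k$ and $v.rank=\max\{0,u.rank-2\}$, add the arc $(v,u)$ so that $u$ acquires $v$ as an additional parent (no children of $u$ are moved), and meld the one-node heap $v$ with the heap. delete($e,h$) removes $e$ from the node $u$ holding it, making $u$ hollow; if $u$ is not the root this completes the operation; otherwise, while some root is hollow, destroy such a root (removing its outgoing arcs, so that children left with no parent become roots); then do ranked links while two roots have equal rank; then do unranked links until one root remains. delete-min($h$) performs delete on the item in the root. Virtual parents (an analysis device, not part of the algorithm), defined along the execution: a newly created node has no virtual parent; when a root with no virtual parent loses a ranked link, the winner becomes its virtual parent; when the virtual parent of a node is destroyed, the node has no virtual parent; when a decrease-key moves an item from a node $u$ to a new node $v$, $v$ becomes the virtual parent of every node whose virtual parent is $u$ and whose rank is less than $v.rank=\max\{0,u.rank-2\}$. Otherwise virtual parents do not change. A node $w$ is a virtual child of $v$ if $v$ is the virtual parent of $w$. *)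

(* Defs.v *)
From mathcomp Require Import all_boot all_order.
From mathcomp Require Import finmap.

Set Implicit Arguments.
Unset Strict Implicit.
Unset Printing Implicit Defensive.

Import Order.TTheory.
Local Open Scope fset_scope.

(** Two-parent hollow heaps as a nondeterministic transition system.  All the
    nodes of all the current heaps live in one graph.  Operations are split into
    elementary steps, so that every intermediate moment of an operation is a
    configuration too; arbitrary choices (ties, order of destructions and links,
    names of new nodes) are left nondeterministic. *)

Definition node := nat.

Inductive vacated_by := ByDecreaseKey | ByDelete.

(* The reason why a node is hollow is not part of the data structure; it is
   recorded because the rank invariant mentions it. *)
Inductive content (item : Type) :=
  | Holds of item
  | Hollow of vacated_by.
Arguments Hollow {item} _.

(* Arcs are pairs (parent, child).  The four functions are meaningful only on
   [nodes]. *)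
Record graph (K item : Type) := Graph {
  nodes : {fset node};
  arcs : {fset node * node};
  held : node -> content item;
  key : node -> K;
  rank : node -> nat;
  vparent : node -> option node
}.

Section Graphs.
Context {d : Order.disp_t} {K : orderType d} {item : Type}.
Implicit Types (g : graph K item) (u v w x : node) (e : item) (k : K).

Definition is_full g u : bool := if held g u is Holds _ then true else false.

Definition hollowed_by_decrease_key g u : bool :=
  if held g u is Hollow ByDecreaseKey then true else false.

Definition is_root g u : bool :=
  (u \in nodes g) && (u \notin [fset a.2 | a in arcs g]).

Definition is_arc g : rel node := fun v w => (v, w) \in arcs g.

(* Reflexive: [u] is a node of the heap with root [x]. *)
Definition reachable_from g x u : Prop :=
  exists2 p, path (is_arc g) x p & u = last x p.

Definition virtual_children g v : {fset node} :=
  [fset w in nodes g | vparent g w == Some v].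

(* [w] may be the winner and [l] the loser of a link; for equal keys both
   outcomes are allowed. *)
Definition can_link g w l : bool :=
  [&& w != l, is_root g w, is_root g l, is_full g w, is_full g l
    & (key g w <= key g l)%O].

Definition unranked_link w l g : graph K item :=
  Graph (nodes g) ((w, l) |` arcs g) (held g) (key g) (rank g) (vparent g).

Definition ranked_link w l g : graph K item :=
  Graph (nodes g) ((w, l) |` arcs g) (held g) (key g)
    [eta rank g with w |-> (rank g w).+1]
    (if vparent g l is None then [eta vparent g with l |-> Some w]
     else vparent g).

Definition add_node v e k r g : graph K item :=
  Graph (v |` nodes g) (arcs g)
    [eta held g with v |-> Holds e] [eta key g with v |-> k]
    [eta rank g with v |-> r] [eta vparent g with v |-> None].

Definition vacate u why g : graph K item :=
  Graph (nodes g) (arcs g) [eta held g with u |-> Hollow why]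
    (key g) (rank g) (vparent g).

Definition set_key u k g : graph K item :=
  Graph (nodes g) (arcs g) (held g) [eta key g with u |-> k]
    (rank g) (vparent g).

(* [e] leaves [u] for the new node [v].  The subtraction is truncated, so that
   [rank g u - 2] is max{0, u.rank - 2}. *)
Definition move_item u v e k g : graph K item :=
  let g1 := vacate u ByDecreaseKey (add_node v e k (rank g u - 2) g) in
  Graph (nodes g1) ((v, u) |` arcs g1) (held g1) (key g1) (rank g1)
    (fun w => if (vparent g1 w == Some u) && (rank g1 w < rank g1 v)%N
              then Some v else vparent g1 w).

Definition destroy x g : graph K item :=
  Graph (nodes g `\ x) [fset a in arcs g | a.1 != x] (held g) (key g) (rank g)
    (fun w => if vparent g w == Some x then None else vparent g w).

End Graphs.

(* [None] is an empty heap, [Some r] the heap with root [r]. *)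
Definition heap := option node.

Inductive operation (K item : Type) :=
  | MakeHeap
  | FindMin of heap
  | Insert of item & K & heap
  | DeleteMin of heap
  | Meld of heap & heap
  | DecreaseKey of item & K & heap
  | Delete of item & heap.
Arguments MakeHeap {K item}.
Arguments FindMin {K item} _.
Arguments DeleteMin {K item} _.
Arguments Meld {K item} _ _.
Arguments Delete {K item} _ _.

(* [Melding h1 h2]: it remains to meld [h1] and [h2] and return the result.
   [Consolidating]: a root has been made hollow by a deletion, and it remains to
   destroy hollow roots and to link the remaining roots. *)
Inductive phase :=
  | Idle
  | Melding of heap & heap
  | Consolidating.

(* [heaps] is the multiset of the current heaps, without those being consumed by
   the operation in progress. *)
Record config (K item : Type) := Config {
  gr : graph K item;
  heaps : seq heap;
  ph : phase
}.

Section Execution.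
Context {d : Order.disp_t} {K : orderType d} {item : Type}.
Implicit Types (c : config K item) (g : graph K item) (hs : seq heap).
Implicit Types (h : heap) (r u v w l x : node) (e : item) (k : K).

Definition initial c : Prop :=
  [/\ nodes (gr c) = fset0, arcs (gr c) = fset0, heaps c = [::] & ph c = Idle].

(* During consolidation the heap being restructured is not in [heaps], hence its
   roots are the roots of the graph that are not the root of a heap of [heaps]. *)
Definition loose_roots g hs : {fset node} :=
  [fset x in nodes g | is_root g x && (Some x \notin hs)].

(* In [BeginDecreaseKey], [u] may be the root, since changing the key in place is
   then only an option; in that case [v], now the parent of [u], is the only root
   and there is nothing left to meld it with. *)
Inductive begins : operation K item -> config K item -> config K item -> Prop :=
  | BeginMakeHeap g hs :
      begins MakeHeap (Config g hs Idle) (Config g (None :: hs) Idle)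
  | BeginFindMin g hs h :
      h \in hs ->
      begins (FindMin h) (Config g hs Idle) (Config g hs Idle)
  | BeginInsert g hs h e k v :
      h \in hs ->
      (forall u, u \in nodes g -> held g u <> Holds e) ->
      v \notin nodes g ->
      begins (Insert e k h) (Config g hs Idle)
        (Config (add_node v e k 0 g) (rem h hs) (Melding (Some v) h))
  | BeginMeld g hs h1 h2 :
      h1 \in hs -> h2 \in rem h1 hs ->
      begins (Meld h1 h2) (Config g hs Idle)
        (Config g (rem h2 (rem h1 hs)) (Melding h1 h2))
  | BeginDecreaseKeyRoot g hs r e k :
      Some r \in hs -> held g r = Holds e -> (k < key g r)%O ->
      begins (DecreaseKey e k (Some r)) (Config g hs Idle)
        (Config (set_key r k g) hs Idle)
  | BeginDecreaseKey g hs r u v e k :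
      Some r \in hs -> reachable_from g r u ->
      held g u = Holds e -> (k < key g u)%O ->
      v \notin nodes g ->
      begins (DecreaseKey e k (Some r)) (Config g hs Idle)
        (Config (move_item u v e k g) (rem (Some r) hs)
           (Melding (Some v) (if u == r then None else Some r)))
  | BeginDeleteNonRoot g hs r u e :
      Some r \in hs -> reachable_from g r u -> held g u = Holds e -> u != r ->
      begins (Delete e (Some r)) (Config g hs Idle)
        (Config (vacate u ByDelete g) hs Idle)
  | BeginDeleteRoot g hs r e :
      Some r \in hs -> held g r = Holds e ->
      begins (Delete e (Some r)) (Config g hs Idle)
        (Config (vacate r ByDelete g) (rem (Some r) hs) Consolidating)
  | BeginDeleteMin c c' r e :
      held (gr c) r = Holds e ->
      begins (Delete e (Some r)) c c' ->
      begins (DeleteMin (Some r)) c c'.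

Inductive continues : config K item -> config K item -> Prop :=
  | MeldEmptyLeft g hs h :
      continues (Config g hs (Melding None h)) (Config g (h :: hs) Idle)
  | MeldEmptyRight g hs h :
      continues (Config g hs (Melding h None)) (Config g (h :: hs) Idle)
  | MeldFirstWins g hs w l :
      can_link g w l ->
      continues (Config g hs (Melding (Some w) (Some l)))
        (Config (unranked_link w l g) (Some w :: hs) Idle)
  | MeldSecondWins g hs w l :
      can_link g w l ->
      continues (Config g hs (Melding (Some l) (Some w)))
        (Config (unranked_link w l g) (Some w :: hs) Idle)
  | DestroyHollowRoot g hs x :
      x \in loose_roots g hs -> ~~ is_full g x ->
      continues (Config g hs Consolidating)
        (Config (destroy x g) hs Consolidating)
  | ConsolidateRanked g hs w l :
      {in loose_roots g hs, forall x, is_full g x} ->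
      w \in loose_roots g hs -> l \in loose_roots g hs ->
      can_link g w l -> rank g w = rank g l ->
      continues (Config g hs Consolidating)
        (Config (ranked_link w l g) hs Consolidating)
  | ConsolidateUnranked g hs w l :
      {in loose_roots g hs, forall x, is_full g x} ->
      {in loose_roots g hs &, injective (rank g)} ->
      w \in loose_roots g hs -> l \in loose_roots g hs ->
      can_link g w l ->
      continues (Config g hs Consolidating)
        (Config (unranked_link w l g) hs Consolidating)
  | ConsolidateEmpty g hs :
      loose_roots g hs = fset0 ->
      continues (Config g hs Consolidating) (Config g (None :: hs) Idle)
  | ConsolidateDone g hs r :
      loose_roots g hs = [fset r] -> is_full g r ->
      continues (Config g hs Consolidating) (Config g (Some r :: hs) Idle).

Inductive occurs : config K item -> Prop :=
  | OccursInitially c : initial c -> occurs c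
  | OccursBegin c o c' : occurs c -> begins o c c' -> occurs c'
  | OccursContinue c c' : occurs c -> continues c c' -> occurs c'.

End Execution.

(* Main.v *)
Require Import Defs.
From mathcomp Require Import all_boot all_order.
From mathcomp Require Import finmap.

(** The rank invariant is strengthened by: a virtual child is a proper descendant
    of its virtual parent.  Arcs disappear only with the destruction of a root,
    and a path starting at a surviving node never meets that root, so this is
    preserved.  Consequently a root has no virtual parent: destroying a root or
    raising the rank of the winner of a ranked link does not disturb the virtual
    children of another node.  Only ranked links and decrease-keys then require a
    computation of ranks. *)

Set Implicit Arguments.
Unset Strict Implicit.
Unset Printing Implicit Defensive.

Local Open Scope fset_scope.

Section RankInvariant.
Context {d : Order.disp_t} {K : orderType d} {item : Type}.
Implicit Types (g : graph K item) (u v w x l : node) (e : item) (k : K).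
Implicit Types (hs : seq heap) (c : config K item).

(** * The strengthened invariant *)

Definition rank_condition g u : bool :=
  let r := rank g u in
  let virtual_child_ranks := [seq rank g w | w <- virtual_children g u] in
  if (2 < r)%N && hollowed_by_decrease_key g u
  then perm_eq virtual_child_ranks [:: r - 2; r - 1]
  else perm_eq virtual_child_ranks (iota 0 r).

(** The path is [y :: p], hence has at least one arc; this is what rules out that a virtual child is
    a root. *)
Definition proper_descendant g v w : Prop :=
  exists y p, path (is_arc g) v (y :: p) /\ w = last y p.

Definition arcs_between_nodes g : Prop :=
  forall v w, is_arc g v w -> v \in nodes g /\ w \in nodes g.

Definition virtual_children_descend g : Prop :=
  forall w v, w \in nodes g -> vparent g w = Some v -> proper_descendant g v w.

Record well_formed g hs : Prop := WellFormed {
  wf_arcs : arcs_between_nodes g;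
  wf_descend : virtual_children_descend g;
  wf_heaps : forall r, Some r \in hs -> r \in nodes g;
  wf_ranks : forall u, u \in nodes g -> rank_condition g u
}.

(** Two heaps waiting to be melded are absent from [heaps c], yet one of them supplies the root of
    the result, so both must be known to be rooted at nodes. A heap under consolidation has no
    single root and contributes nothing. *)
Definition live_heaps c : seq heap :=
  if ph c is Melding h1 h2 then [:: h1, h2 & heaps c] else heaps c.

(** * Paths, roots and virtual children *)

Lemma in_virtual_children g v w :
  (w \in virtual_children g v) = (w \in nodes g) && (vparent g w == Some v).
Proof. by rewrite !inE. Qed.

Lemma is_rootP g u :
  reflect (u \in nodes g /\ forall v, ~~ is_arc g v u) (is_root g u).
Proof.
apply: (iffP andP) => -[ug H]; split=> //.
  by move=> v; apply: contra H => vu; apply/imfsetP; exists (v, u).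
by apply/imfsetP => -[[v w] /= vw uw]; case/negP: (H v); rewrite uw.
Qed.

Lemma proper_descendant_has_parent g v w :
  proper_descendant g v w -> exists x, is_arc g x w.
Proof.
case=> y [p [+ ->]]; elim: p v y => [|z p IH] v y /= /andP[vy].
  by exists v.
exact: IH.
Qed.

Lemma proper_descendant_ancestor g v w :
  proper_descendant g v w -> exists x, is_arc g v x.
Proof. by case=> y [p [/= /andP[vy _] _]]; exists y. Qed.

Lemma proper_descendant_mono g g' v w :
  {subset arcs g <= arcs g'} ->
  proper_descendant g v w -> proper_descendant g' v w.
Proof.
move=> sub [y [p [vp ->]]]; exists y, p; split=> //.
by apply: sub_path vp => a b; apply: sub.
Qed.

Lemma root_vparent g x :
  virtual_children_descend g -> is_root g x -> vparent g x = None.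
Proof.
move=> desc /is_rootP[xg xP]; case E: (vparent g x) => [v|] //.
have [y] := proper_descendant_has_parent (desc _ _ xg E).
by rewrite (negPf (xP y)).
Qed.

(** The virtual parent is the source of an arc. The lemma guarantees that a fresh node is not yet
    the virtual parent of any node. *)
Lemma vparent_node g v w :
  arcs_between_nodes g -> virtual_children_descend g ->
  w \in nodes g -> vparent g w = Some v -> v \in nodes g.
Proof.
move=> arcsP desc wg wv; have [x] := proper_descendant_ancestor (desc _ _ wg wv).
by case/arcsP.
Qed.

Lemma reachable_node g r u :
  arcs_between_nodes g -> r \in nodes g -> reachable_from g r u -> u \in nodes g.
Proof.
move=> arcsP + [p + ->]; elim: p r => //= y p IH r rg /andP[ry].
by apply: IH; case: (arcsP _ _ ry).
Qed.

Lemma perm_virtual_children g u (s : seq node) :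
  uniq s -> virtual_children g u =i s -> perm_eq (virtual_children g u) s.
Proof. by move=> us eqs; apply: uniq_perm => //; apply: fset_uniq. Qed.

(** Frame rule for the nodes that an elementary step leaves alone. *)
Lemma rank_condition_ext g g' u :
  virtual_children g' u =i virtual_children g u ->
  {in virtual_children g u, rank g' =1 rank g} ->
  rank g' u = rank g u ->
  hollowed_by_decrease_key g' u = hollowed_by_decrease_key g u ->
  rank_condition g' u = rank_condition g u.
Proof.
move=> /fsetP eqc eqr equ eqh; rewrite /rank_condition equ eqh eqc.
by move/eq_in_map: eqr => ->.
Qed.

Lemma full_rank_condition g u :
  ~~ hollowed_by_decrease_key g u ->
  rank_condition g u
  = perm_eq [seq rank g w | w <- virtual_children g u] (iota 0 (rank g u)).
Proof. by rewrite /rank_condition => /negPf->; rewrite andbF. Qed.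

(** * Preservation by changes of the graph *)

Lemma well_formed_sub g hs hs' :
  {subset hs' <= None :: hs} -> well_formed g hs -> well_formed g hs'.
Proof.
move=> sub [A D H R]; split=> // r /sub; rewrite inE; exact: H.
Qed.

Lemma well_formed_set_key g hs u k :
  well_formed g hs -> well_formed (set_key u k g) hs.
Proof. by case. Qed.

(** Neither a full node nor one hollowed by a deletion falls under the exceptional case, so the
    condition on [u] stays the same. *)
Lemma well_formed_vacate_delete g hs u e :
  held g u = Holds e -> well_formed g hs ->
  well_formed (vacate u ByDelete g) hs.
Proof.
move=> ue [A D H R]; split=> // w wg; rewrite (@rank_condition_ext g) ?R //.
by rewrite /hollowed_by_decrease_key /=; case: eqP => // ->; rewrite ue.
Qed.

Lemma well_formed_unranked_link g hs w l :
  w \in nodes g -> l \in nodes g ->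
  well_formed g hs -> well_formed (unranked_link w l g) hs.
Proof.
move=> wg lg [A D H R]; split=> //.
- by move=> a b; rewrite /is_arc !inE => /predU1P[[-> ->]|/A].
- move=> a b ag /(D _ _ ag); apply: proper_descendant_mono => z zg.
  by rewrite !inE zg orbT.
Qed.

(** The loser has no virtual parent, so the winner gains it and no other node loses it. Its rank is
    the old rank [r] of the winner, which extends [0, ..., r - 1] to the ranks required at
    [r.+1]. *)
Lemma well_formed_ranked_link g hs w l :
  can_link g w l -> rank g w = rank g l ->
  well_formed g hs -> well_formed (ranked_link w l g) hs.
Proof.
move=> /and5P[wl wroot lroot wfull _] eqr [A D H R].
have [[wg _] [lg _]] := (is_rootP _ _ wroot, is_rootP _ _ lroot).
have [w0 l0] := (root_vparent D wroot, root_vparent D lroot).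
have sub : {subset arcs g <= arcs (ranked_link w l g)}.
  by move=> z zg; rewrite !inE zg orbT.
have vc u : u != w ->
    virtual_children (ranked_link w l g) u =i virtual_children g u.
  move=> uw x; rewrite !in_virtual_children /= l0 /=.
  case: (eqVneq x l) => // ->; rewrite l0 lg /=; apply/eqP => -[] wu.
  by rewrite wu eqxx in uw.
split=> //.
- by move=> a b; rewrite /is_arc !inE => /predU1P[[-> ->]|/A].
- move=> a b /= ag; rewrite l0 /=; case: eqP => [-> [<-]|_ /(D _ _ ag)].
    by exists l, [::]; rewrite /= /is_arc !inE eqxx.
  exact: proper_descendant_mono.
(* Only the rank of [w] changes, and [w] is a root, hence a virtual child of no node. *)
have stable u : {in virtual_children g u,
    rank (ranked_link w l g) =1 rank g}.
  move=> x; rewrite in_virtual_children /= => /andP[_ /eqP xu].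
  by case: eqP => // xw; rewrite xw w0 in xu.
move=> u ug; have [->|uw] := eqVneq u w; last first.
  rewrite (@rank_condition_ext g) ?R //; first exact: vc.
  by rewrite /= (negPf uw).
have nhw : ~~ hollowed_by_decrease_key g w.
  by move: wfull; rewrite /is_full /hollowed_by_decrease_key; case: held.
have := R w wg; rewrite !full_rank_condition // => Rw.
have lnw : l \notin virtual_children g w.
  by rewrite in_virtual_children l0 andbF.
have /(perm_map (rank (ranked_link w l g))) Pw :
    perm_eq (virtual_children (ranked_link w l g) w) (l :: virtual_children g w).
  apply: perm_virtual_children; first by rewrite /= lnw fset_uniq.
  move=> x; rewrite in_cons !in_virtual_children /= l0 /=.
  by case: (eqVneq x l) => [->|]; rewrite ?lg ?eqxx.
rewrite (perm_trans Pw) //= eqxx.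
move/eq_in_map: (stable w) => ->; rewrite eq_sym (negPf wl) -eqr.
(* The rank of [l] is the last entry of the longer [iota], but [l] was put first among the virtual
   children. *)
by rewrite -addn1 iotaD cats1 perm_sym perm_rcons perm_cons perm_sym.
Qed.

(** Being a root, [x] is missing from every set of virtual children; the nodes that lose their
    virtual parent had [x] itself as virtual parent. *)
Lemma well_formed_destroy g hs x :
  is_root g x -> Some x \notin hs ->
  well_formed g hs -> well_formed (destroy x g) hs.
Proof.
move=> xroot xhs [A D H R]; have [xg xP] := is_rootP _ _ xroot.
have x0 := root_vparent D xroot.
have arcE a b : is_arc (destroy x g) a b = is_arc g a b && (a != x).
  by rewrite /is_arc !inE.
have pathP p v : v != x -> path (is_arc g) v p -> path (is_arc (destroy x g)) v p.
  elim: p v => //= y p IH v vx /andP[vy yp]; rewrite arcE vy vx /= IH //.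
  by apply/eqP => yx; rewrite yx (negPf (xP v)) in vy.
split=> //.
- move=> a b; rewrite arcE => /andP[ab ax]; have [ag bg] := A _ _ ab.
  rewrite !inE ax ag bg !andbT; split=> //.
  by apply/eqP => bx; rewrite bx (negPf (xP a)) in ab.
- move=> w v; rewrite !inE /= => /andP[wx wg].
  case: eqP => // wnx wv; have [y [p [vp ->]]] := D _ _ wg wv.
  exists y, p; split=> //; apply: pathP => //.
  by apply/eqP => vx; apply: wnx; rewrite wv vx.
- move=> r rhs; rewrite !inE H // andbT.
  by apply/eqP => rx; rewrite -rx rhs in xhs.
move=> u; rewrite !inE => /andP[ux ug]; rewrite (@rank_condition_ext g) ?R //.
move=> w; rewrite !in_virtual_children !inE /=.
have [->|wx] := eqVneq w x; first by rewrite /= x0 andbF.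
congr (_ && _); case: (eqVneq (vparent g w) (Some x)) => // ->.
by apply/esym/eqP => -[xu]; rewrite xu eqxx in ux.
Qed.

Lemma well_formed_insert g hs v e k :
  v \notin nodes g -> well_formed g hs ->
  well_formed (add_node v e k 0 g) (Some v :: hs).
Proof.
move=> vg [A D H R].
have old w : w \in nodes g -> (w == v) = false.
  by move=> wg; apply/eqP => wv; rewrite -wv wg in vg.
split=> //.
- by move=> a b /A[ag bg]; rewrite !inE ag bg !orbT.
- move=> w u; rewrite !inE /=; case: eqP => //= _ wg; exact: D.
- by move=> r; rewrite !inE => /predU1P[[->]|/H ->]; rewrite ?eqxx ?orbT.
move=> u; rewrite !inE; have [->|uv] /= := eqVneq u v => [_|ug].
  rewrite full_rank_condition; last first.
    by rewrite /hollowed_by_decrease_key /= eqxx.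
  rewrite /= eqxx /=.
  suff -> : virtual_children (add_node v e k 0 g) v = fset0 by [].
  apply/fsetP => w; rewrite in_virtual_children !inE /=.
  case: (eqVneq w v) => //= _; apply/negP => /andP[wg /eqP wv].
  by rewrite (vparent_node A D wg wv) in vg.
rewrite (@rank_condition_ext g) ?R //=.
- move=> w; rewrite !in_virtual_children !inE /=.
  by case: (eqVneq w v) => // ->; rewrite (negPf vg).
- by move=> w; rewrite in_virtual_children => /andP[/old->].
- by rewrite (negPf uv).
by rewrite /hollowed_by_decrease_key /= (negPf uv).
Qed.

(** With [r] the rank of [u], the virtual children of [u] have ranks [0, ..., r - 1], since [u] is
    full before the move. Those of rank below [r - 2] pass to [v], whose rank is [r - 2]; the others
    stay. For [r <= 2] the truncated difference is 0 and none of them moves, hence the bound in the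
    exceptional case. *)
Lemma well_formed_move_item g hs u v e e' k :
  u \in nodes g -> held g u = Holds e' -> v \notin nodes g ->
  well_formed g hs -> well_formed (move_item u v e k g) (Some v :: hs).
Proof.
move=> ug ue vg [A D H R]; set g' := move_item u v e k g.
have old w : w \in nodes g -> (w == v) = false.
  by move=> wg; apply/eqP => wv; rewrite -wv wg in vg.
have rankE w : w \in nodes g -> rank g' w = rank g w.
  by move=> /old /= ->.
have rankv : rank g' v = rank g u - 2 by rewrite /= eqxx.
have vparentE w : w \in nodes g ->
    vparent g' w = if (vparent g w == Some u) && (rank g w < rank g u - 2)
                   then Some v else vparent g w.
  by move=> /old /= ->; rewrite eqxx.
have vparentv : vparent g' v = None by rewrite /= eqxx.
have nodesE w : (w \in nodes g') = (w == v) || (w \in nodes g).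
  by rewrite !inE.
have arcE a b : is_arc g' a b = ((a == v) && (b == u)) || is_arc g a b.
  by rewrite /is_arc !inE.
have sub : {subset arcs g <= arcs g'}.
  by move=> z zg; rewrite !inE zg orbT.
have uv := old u ug.
have heldE w : w != u -> w \in nodes g -> held g' w = held g w.
  by move=> /negPf wu /old wv /=; rewrite wu wv.
have in_vc x w :
    (w \in virtual_children g' x)
    = (w \in nodes g) &&
      ((if (vparent g w == Some u) && (rank g w < rank g u - 2)
        then Some v else vparent g w) == Some x).
  rewrite in_virtual_children nodesE; have [->|_] := eqVneq w v.
    by rewrite vparentv (negPf vg).
  by rewrite /=; case wg: (w \in nodes g) => //=; rewrite -vparentE.
have rank_vc x : {in virtual_children g x, rank g' =1 rank g}.
  by move=> w; rewrite in_virtual_children => /andP[/rankE].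
have no_vc_v w : w \in nodes g -> vparent g w == Some v = false.
  by move=> wg; apply/eqP => wv; rewrite (vparent_node A D wg wv) in vg.
have heldv : held g' v = Holds e by rewrite /= eqxx eq_sym uv.
have heldu : held g' u = Hollow ByDecreaseKey by rewrite /= eqxx.
have Ru : perm_eq [seq rank g w | w <- virtual_children g u]
                  (iota 0 (rank g u)).
  by rewrite -full_rank_condition ?R // /hollowed_by_decrease_key ue.
(* From here on [g'] is known only through the equations above. *)
clearbody g'; split.
- move=> a b; rewrite arcE !nodesE => /orP[/andP[/eqP-> /eqP->]|/A[-> ->]].
    by rewrite eqxx ug orbT.
  by rewrite !orbT.
- move=> w x; rewrite nodesE; have [->|_ /= wg] := eqVneq w v.
    by rewrite vparentv.
  rewrite vparentE //; case: ifP => [/andP[/eqP wu _] [<-]|_ wx].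
    (* The new arc from [v] to [u] is prepended to the old path from [u] to [w]. *)
    have [y [p [/(sub_path (fun a b => sub (a, b))) up ->]]] := D _ _ wg wu.
    exists u, (y :: p); split=> //.
    by rewrite -[path _ _ _]/(is_arc g' v u && path (is_arc g') u (y :: p))
               arcE !eqxx.
  exact: proper_descendant_mono (D _ _ wg wx).
- by move=> r; rewrite inE nodesE => /predU1P[[->]|/H ->]; rewrite ?eqxx ?orbT.
(* Used twice: for the virtual children passed to [v] and for those kept by [u], each selected by
   rank from the old ones of [u]. *)
have split_ranks (P : pred nat) x :
    virtual_children g' x =i
      [seq w <- virtual_children g u | P (rank g w)] ->
    perm_eq [seq rank g' w | w <- virtual_children g' x]
            [seq i <- iota 0 (rank g u) | P i].
  move=> eqc; have /(perm_map (rank g')) Px :=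
    perm_virtual_children (filter_uniq _ (fset_uniq _)) eqc.
  apply: perm_trans Px _.
  rewrite (_ : map _ _ =
    [seq i <- [seq rank g w | w <- virtual_children g u] | P i]).
    exact: perm_filter.
  rewrite filter_map; apply/eq_in_map => w; rewrite mem_filter => /andP[_].
  exact: rank_vc.
move=> x; rewrite nodesE; have [->|xv /= xg] := eqVneq x v => [_|].
  rewrite full_rank_condition; last by rewrite /hollowed_by_decrease_key heldv.
  rewrite -[iota _ _](@filter_iota_ltn 0 (rank g u)) rankv ?leq_subr //.
  apply: (split_ranks (fun i => i < rank g u - 2)) => w.
  rewrite in_vc mem_filter in_virtual_children [RHS]andbCA.
  case wg: (w \in nodes g); rewrite ?andbF //=.
  by rewrite andbC; case: ifP; rewrite ?eqxx ?no_vc_v.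
have [xu|xu] := eqVneq x u; last first.
  rewrite (@rank_condition_ext g) ?R ?rankE //.
    move=> w; rewrite in_vc in_virtual_children; congr (_ && _).
    (* A redirected node changes its virtual parent from [u] to [v], and [x] is neither. *)
    case: ifP => // /andP[/eqP-> _].
    by rewrite !(inj_eq Some_inj) eq_sym (negPf xv) eq_sym (negPf xu).
  by rewrite /hollowed_by_decrease_key heldE.
have Pu : perm_eq [seq rank g' w | w <- virtual_children g' u]
                  [seq i <- iota 0 (rank g u) | rank g u - 2 <= i].
  apply: split_ranks => w.
  rewrite in_vc mem_filter in_virtual_children.
  case wg: (w \in nodes g); rewrite ?andbF //=.
  have [->|/negPf neq] := eqVneq (vparent g w) (Some u); last first.
    by rewrite /= neq andbF.
  rewrite andbT; case: ltnP; rewrite ?eqxx // => _.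
  by rewrite (inj_eq Some_inj) eq_sym uv.
rewrite xu /rank_condition rankE // /hollowed_by_decrease_key heldu andbT.
case: ltnP => [r2|r2]; apply: perm_trans Pu _; last first.
  (* [r2] unfolds to [rank g u - 2 == 0], so the filter keeps everything. *)
  by rewrite (eqP r2) filter_predT.
(* The [iota] is cut at [r - 2]: the filter empties the first piece and keeps the two entries
   [r - 2] and [(r - 2).+1] of the second. *)
rewrite -{2}(subnK (ltnW r2)) iotaD filter_cat.
rewrite (eq_in_filter (a2 := pred0)) => [|i]; last first.
  by rewrite mem_iota add0n ltnNge => /andP[_ /negPf].
rewrite filter_pred0 /= leqnn leqnSn.
by rewrite -subSn // ltnW.
Qed.

(** * Preservation along executions *)

Lemma begins_well_formed o c c' :
  begins o c c' -> well_formed (gr c) (live_heaps c) ->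
  well_formed (gr c') (live_heaps c').
Proof.
(* Induction rather than case analysis, because a delete-min begins as a delete. *)
elim=> {o c c'} //=.
- by move=> g hs; apply: well_formed_sub.
- move=> g hs h e k v hhs _ vg /(well_formed_insert e k vg).
  rewrite /live_heaps /=; apply: well_formed_sub => x.
  rewrite !inE => /or3P[->|/eqP->|/mem_rem ->]; rewrite ?hhs ?orbT //.
- move=> g hs h1 h2 h1s h2s; apply: well_formed_sub => x.
  rewrite !inE => /or3P[/eqP->|/eqP->|/mem_rem/mem_rem->].
  + by rewrite h1s orbT.
  + by rewrite (mem_rem h2s) orbT.
  + by rewrite orbT.
- by move=> g hs r e k _ _ _; apply: well_formed_set_key.
- move=> g hs r u v e k rhs ru ue _ vg wf.
  have ug := reachable_node (wf_arcs wf) (wf_heaps wf rhs) ru.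
  have := well_formed_move_item e k ug ue vg wf.
  rewrite /live_heaps /=; apply: well_formed_sub => x.
  by case: (u == r); rewrite !inE => /or3P[->|/eqP->|/mem_rem->];
    rewrite ?rhs ?orbT.
- by move=> g hs r u e _ _ ue _; apply: well_formed_vacate_delete ue.
- move=> g hs r e _ re /(well_formed_vacate_delete re).
  apply: well_formed_sub => x /mem_rem xhs.
  by rewrite inE xhs orbT.
Qed.

Lemma loose_rootP g hs x :
  x \in loose_roots g hs ->
  [/\ x \in nodes g, is_root g x & Some x \notin hs].
Proof. by rewrite !inE => /and3P. Qed.

Lemma continues_well_formed c c' :
  continues c c' -> well_formed (gr c) (live_heaps c) ->
  well_formed (gr c') (live_heaps c').
Proof.
have link g hs w l : can_link g w l ->
    well_formed g hs -> well_formed (unranked_link w l g) hs.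
  move=> /and5P[_ /is_rootP[wg _] /is_rootP[lg _] _ _].
  exact: well_formed_unranked_link.
case=> {c c'}; rewrite /live_heaps /=.
- by move=> g hs h; apply: well_formed_sub => x; rewrite !inE => ->; rewrite !orbT.
- move=> g hs h; apply: well_formed_sub => x.
  by rewrite !inE => /orP[]->; rewrite ?orbT //.
- move=> g hs w l /link/[apply]; apply: well_formed_sub => x.
  by rewrite !inE => /orP[]->; rewrite ?orbT //.
- move=> g hs w l /link/[apply]; apply: well_formed_sub => x.
  by rewrite !inE => /orP[]->; rewrite ?orbT //.
- by move=> g hs x /loose_rootP[_ xr xhs] _; apply: well_formed_destroy.
- by move=> g hs w l _ _ _; apply: well_formed_ranked_link.
- by move=> g hs w l _ _ _ _; apply: link.
- by move=> g hs _; apply: well_formed_sub.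
(* The root [r] enters the list of heaps anew; it is a node because it is a loose root. *)
- move=> g hs r eqr _ [A D H R]; split=> // x.
  rewrite inE => /predU1P[[->]|/H//].
  have /loose_rootP[] // : r \in loose_roots g hs by rewrite eqr inE.
Qed.

Lemma occurs_well_formed c : occurs c -> well_formed (gr c) (live_heaps c).
Proof.
elim=> {c} [c [n0 a0 h0 p0]|c o c' _ wf cc'|c c' _ wf cc'].
- rewrite /live_heaps p0 h0; split=> // [v w|w v|u].
  + by rewrite /is_arc a0 inE.
  + by rewrite n0 inE.
  + by rewrite n0 inE.
- exact: begins_well_formed cc' wf.
- exact: continues_well_formed cc' wf.
Qed.

End RankInvariant.

Theorem theorem4p5 (d : Order.disp_t) (K : orderType d) (item : Type)
    (c : config K item) (hc : occurs c) (u : node) (hu : u \in nodes (gr c)) :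
  let g := gr c in
  let r := rank g u in
  let virtual_child_ranks := [seq rank g w | w <- virtual_children g u] in
  if (2 < r)%N && hollowed_by_decrease_key g u
  then perm_eq virtual_child_ranks [:: r - 2; r - 1]
  else perm_eq virtual_child_ranks (iota 0 r).
Proof. exact: wf_ranks (occurs_well_formed hc) _ hu. Qed.
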